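(* Let $(M,\alpha_M)$ and $(N,\alpha_N)$ be Hom-Lie algebras acting on each other by compatible Hom-actions. Then the quotient vector space $(M\otimes N)/D(M,N)$, with the product given on (classes of) generators by $$[m\otimes n, m'\otimes n']=-{}^{n}m\otimes {}^{m'}n',\qquad m,m'\in M,\ n,n'\in N,$$ together with the endomorphism $(M\otimes N)/D(M,N)\to (M\otimes N)/D(M,N)$ induced by $\alpha_{M\otimes N}$, is a Hom-Lie algebra.
   Context: All vector spaces, linear maps and tensor products are over a fixed field $\mathbb{K}$. A Hom-Lie algebra $(L,\alpha_L)$ is a vector space $L$ with a bilinear product $[-,-]$ and a linear map $\alpha_L:L\to L$ such that $[x,y]=-[y,x]$, $[\alpha_L(x),[y,z]]+[\alpha_L(z),[x,y]]+[\alpha_L(y),[z,x]]=0$ and (multiplicativity, always assumed) $\alpha_L[x,y]=[\alpha_L(x),\alpha_L(y)]$ for all $x,y,z\in L$. A Hom-action of $(L,\alpha_L)$ on $(M,\alpha_M)$ is a linear map $L\otimes M\to M$, $x\otimes m\mapsto {}^xm$, such that for all $x,y\in L$, $m,m'\in M$: (a) ${}^{[x,y]}\alpha_M(m)={}^{\alpha_L(x)}({}^ym)-{}^{\alpha_L(y)}({}^xm)$; (b) ${}^{\alpha_L(x)}[m,m']=[{}^xm,\alpha_M(m')]+[\alpha_M(m),{}^xm']$; (c) $\alpha_M({}^xm)={}^{\alpha_L(x)}\alpha_M(m)$. Hom-actions of $(M,\alpha_M)$ and $(N,\alpha_N)$ on each other are compatible if ${}^{({}^mn)}m'=[m',{}^nm]$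 and ${}^{({}^nm)}n'=[n',{}^mn]$ for all $m,m'\in M$, $n,n'\in N$. $\alpha_{M\otimes N}:M\otimes N\to M\otimes N$ is the linear map $\alpha_{M\otimes N}(m\otimes n)=\alpha_M(m)\otimes\alpha_N(n)$. $D(M,N)$ is the subspace of $M\otimes N$ generated by all elements of the form (a) $[m,m']\otimes\alpha_N(n)-\alpha_M(m)\otimes{}^{m'}n+\alpha_M(m')\otimes{}^mn$; (b) $\alpha_M(m)\otimes[n,n']-{}^{n'}m\otimes\alpha_N(n)+{}^nm\otimes\alpha_N(n')$; (c) ${}^nm\otimes{}^mn$; (d) ${}^nm\otimes{}^{m'}n'+{}^{n'}m'\otimes{}^mn$; (e) $[{}^nm,{}^{n'}m']\otimes\alpha_N({}^{m''}n'')+[{}^{n'}m',{}^{n''}m'']\otimes\alpha_N({}^mn)+[{}^{n''}m'',{}^nm]\otimes\alpha_N({}^{m'}n')$, for $m,m',m''\in M$, $n,n',n''\in N$.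
   Formalization: When the field has characteristic 2, the formal theorem additionally assumes [x,x]=0 for all x in M and in N; with only [x,y]=-[y,x] the product on the quotient need not be well defined there. *)

(* Defs.v *)
From HB Require Import structures.
From mathcomp Require Import all_boot all_algebra.
From mathcomp Require Import boolp.
From mathcomp.multinomials Require Import freeg.

Set Implicit Arguments.
Unset Strict Implicit.
Unset Printing Implicit Defensive.

Import GRing.Theory.
Import Quotient.Exports.

Local Open Scope ring_scope.
Local Open Scope quotient_scope.

Section Span.
Variables (K : fieldType) (V : lmodType K) (G : V -> Prop).

(* The smallest subspace containing G; subspaces are boolean predicates, which
   is no restriction classically. *)
Definition spanned : {pred V} := fun v =>
  `[< forall S : {pred V}, submod_closed S -> (forall w, G w -> w \in S) ->
      v \in S >].

Lemma spannedP v :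
  reflect (forall S : {pred V}, submod_closed S ->
             (forall w, G w -> w \in S) -> v \in S) (v \in spanned).
Proof. exact: asboolP. Qed.

Lemma mem_spanned v : G v -> v \in spanned.
Proof. by move=> Gv; apply/spannedP => S _; apply. Qed.

Fact spanned_submod_closed : submod_closed spanned.
Proof.
split=> [|a u v /spannedP Su /spannedP Sv]; apply/spannedP => S Scl GS.
  by case: Scl.
by have [_] := Scl; apply; [apply: Su | apply: Sv].
Qed.

HB.instance Definition _ :=
  GRing.isSubmodClosed.Build K V spanned
    (GRing.submod_closed_semi spanned_submod_closed).

Definition quotv := Quotient.quot spanned.

HB.instance Definition _ := GRing.Zmodule.on quotv.

Definition cls (v : V) : quotv := \pi_(Quotient.quot spanned) v.

Lemma cls_eqP u v : reflect (cls u = cls v) (u - v \in spanned).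
Proof. by rewrite Quotient.idealrBE; apply: eqP. Qed.

Lemma cls_eq0P v : reflect (cls v = 0) (v \in spanned).
Proof.
have <- : cls 0 = 0 by rewrite /cls raddf0.
by rewrite -[v in v \in _]subr0; apply: cls_eqP.
Qed.

Lemma cls_surj q : exists v, q = cls v.
Proof. by exists (repr q); rewrite /cls reprK. Qed.

Definition quotv_scale (a : K) (q : quotv) : quotv :=
  cls (a *: repr (q : Quotient.quot spanned)).

Fact cls_zmod_morphism : zmod_morphism cls.
Proof. by move=> u v; rewrite /cls raddfB. Qed.

HB.instance Definition _ :=
  GRing.isZmodMorphism.Build V quotv cls cls_zmod_morphism.

Lemma quotv_scaleE a v : quotv_scale a (cls v) = cls (a *: v).
Proof.
apply/cls_eqP; rewrite -scalerBr rpredZ //.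
by apply/cls_eqP; rewrite /cls reprK.
Qed.

Fact quotv_scaleA a b q :
  quotv_scale a (quotv_scale b q) = quotv_scale (a * b) q.
Proof. by have [v ->] := cls_surj q; rewrite !quotv_scaleE scalerA. Qed.

Fact quotv_scale1 : left_id 1 quotv_scale.
Proof. by move=> q; have [v ->] := cls_surj q; rewrite quotv_scaleE scale1r. Qed.

Fact quotv_scaleDr : right_distributive quotv_scale +%R.
Proof.
move=> a p q; have [u ->] := cls_surj p; have [v ->] := cls_surj q.
by rewrite -raddfD !quotv_scaleE scalerDr raddfD.
Qed.

Fact quotv_scaleDl q : {morph quotv_scale^~ q : a b / a + b}.
Proof.
by move=> a b; have [v ->] := cls_surj q; rewrite !quotv_scaleE scalerDl raddfD.
Qed.

HB.instance Definition _ := GRing.Zmodule_isLmodule.Build K quotv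
  quotv_scaleA quotv_scale1 quotv_scaleDr quotv_scaleDl.

Fact cls_scalable : scalable cls.
Proof. by move=> a v; rewrite -quotv_scaleE. Qed.

HB.instance Definition _ :=
  GRing.isScalable.Build K V quotv *:%R cls cls_scalable.

Section Lift.
Variables (W : lmodType K) (f : {linear V -> W}).
Hypothesis f0 : forall v, G v -> f v = 0.

Lemma spanned_ker v : v \in spanned -> f v = 0.
Proof.
move=> /spannedP /(_ (fun x => f x == 0)) vker; apply/eqP/vker.
  split=> [|a x y]; first by rewrite unfold_in /= linear0.
  by rewrite !unfold_in /= => /eqP fx /eqP fy; rewrite linearP fx fy scaler0 addr0.
by move=> w /f0 fw; rewrite unfold_in /= fw.
Qed.

Definition quotv_lift (q : quotv) : W := f (repr (q : Quotient.quot spanned)).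

Lemma quotv_liftE v : quotv_lift (cls v) = f v.
Proof.
apply/eqP; rewrite -subr_eq0 -raddfB; apply/eqP/spanned_ker.
by apply/cls_eqP; rewrite /cls reprK.
Qed.

Fact quotv_lift_linear : linear quotv_lift.
Proof.
move=> a p q; have [u ->] := cls_surj p; have [v ->] := cls_surj q.
by rewrite -linearP !quotv_liftE linearP.
Qed.

End Lift.
End Span.

Section Tensor.
Variables (K : fieldType) (M N : lmodType K).

(* M ⊗ N is the vector space with basis the pairs (m, n), modulo bilinearity. *)
Inductive tensor_rel : {freeg (M * N)%type / K} -> Prop :=
| Tensor_addl m m' n :
    tensor_rel (<< (m + m', n) >> - << (m, n) >> - << (m', n) >>)
| Tensor_addr m n n' :
    tensor_rel (<< (m, n + n') >> - << (m, n) >> - << (m, n') >>)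
| Tensor_scalel a m n :
    tensor_rel (<< (a *: m, n) >> - a *: << (m, n) >>)
| Tensor_scaler a m n :
    tensor_rel (<< (m, a *: n) >> - a *: << (m, n) >>).

Definition tensor := quotv tensor_rel.

HB.instance Definition _ := GRing.Lmodule.on tensor.

Definition tens (m : M) (n : N) : tensor := cls tensor_rel << (m, n) >>.

Fact tens_bilinear : bilinear_for *:%R *:%R tens.
Proof.
have split3 (V : zmodType) (x y z w : V) : x - (y + z) = (x - w - z) + (w - y).
  by rewrite [x - w - z]addrAC addrA subrK opprD addrA addrAC.
split=> [n a m m'|m a n n'] /=; rewrite /tens -linearP; apply/cls_eqP.
  rewrite (split3 _ _ _ _ << (a *: m, n) >>) rpredD //; apply: mem_spanned.
    exact: Tensor_addl.
  exact: Tensor_scalel.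
rewrite (split3 _ _ _ _ << (m, a *: n) >>) rpredD //; apply: mem_spanned.
  exact: Tensor_addr.
exact: Tensor_scaler.
Qed.

HB.instance Definition _ :=
  bilinear_isBilinear.Build K M N tensor *:%R *:%R tens tens_bilinear.

Section TensorLift.
Variables (V : lmodType K) (f : {bilinear M -> N -> V}).

Definition freeg_lift : {freeg (M * N)%type / K} -> V :=
  fglift (fun x => f x.1 x.2).

Lemma freeg_liftU a x : freeg_lift << a *g x >> = a *: f x.1 x.2.
Proof. exact: liftU. Qed.

Fact freeg_lift_zmod : zmod_morphism freeg_lift.
Proof. exact: lift_is_additive. Qed.

HB.instance Definition _ := GRing.isZmodMorphism.Build
  {freeg (M * N)%type / K} V freeg_lift freeg_lift_zmod.

Fact freeg_lift_scalable : scalable freeg_lift.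
Proof.
move=> a D; rewrite -[D in RHS]freeg_sumE /= [a *: D]/(fgscale a D) /fgscale.
rewrite !raddf_sum; apply: eq_bigr => x _.
by rewrite /= !freeg_liftU scalerA.
Qed.

HB.instance Definition _ := GRing.isScalable.Build K
  {freeg (M * N)%type / K} V *:%R freeg_lift freeg_lift_scalable.

Fact freeg_lift0 D : tensor_rel D -> freeg_lift D = 0.
Proof.
case=> *; rewrite !raddfB /= ?linearZ /= !freeg_liftU !scale1r /=.
- by rewrite linearDl /= addrAC addrK subrr.
- by rewrite linearDr /= addrAC addrK subrr.
- by rewrite linearZl_LR scalerN subrr.
- by rewrite linearZr_LR scalerN subrr.
Qed.

Definition tensor_lift : tensor -> V :=
  @quotv_lift K _ tensor_rel V freeg_lift.

Lemma tensor_liftE m n : tensor_lift (tens m n) = f m n.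
Proof.
by rewrite /tensor_lift (quotv_liftE freeg_lift0) /= freeg_liftU scale1r.
Qed.

HB.instance Definition _ := GRing.isLinear.Build K tensor V *:%R tensor_lift
  (quotv_lift_linear freeg_lift0).

End TensorLift.

Lemma tensor_ind (P : tensor -> Prop) :
    (forall m n, P (tens m n)) -> P 0 ->
    (forall a t u, P t -> P u -> P (a *: t + u)) ->
  forall t, P t.
Proof.
move=> Ptens P0 PD t; have [D ->] := cls_surj t; rewrite -[D]freeg_sumE.
elim: (dom D) => [|x s IHs]; first by rewrite big_nil raddf0.
rewrite big_cons raddfD /=.
have -> : << coeff x D *g x >> = coeff x D *: << x >> :> {freeg _ / _}.
  by apply/eqP/freeg_eqP => y; rewrite coeffZ !coeffU mul1r.
by rewrite linearZ /=; apply: PD => //; case: x => m n; apply: Ptens.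
Qed.

Lemma tensor_ext (V : lmodType K) (f g : {linear tensor -> V}) :
  (forall m n, f (tens m n) = g (tens m n)) -> f =1 g.
Proof.
move=> fg; apply: tensor_ind => [//||a t u ft fu]; first by rewrite !linear0.
by rewrite !linearP ft fu.
Qed.

End Tensor.

Arguments tens {K M N} m n.
Notation "m ⊗ n" := (tens m n) (at level 40, left associativity) : ring_scope.

Section TensorMap.
Variables (K : fieldType) (M N M' N' : lmodType K).
Variables (f : {linear M -> M'}) (g : {linear N -> N'}).

Definition tensor_map_fun (m : M) (n : N) : tensor M' N' := f m ⊗ g n.

Fact tensor_map_fun_bilinear : bilinear_for *:%R *:%R tensor_map_fun.
Proof.
by split=> [n|m] a x y; rewrite /tensor_map_fun linearP ?linearPl ?linearPr.
Qed.

HB.instance Definition _ := bilinear_isBilinear.Build K M N (tensor M' N')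
  *:%R *:%R tensor_map_fun tensor_map_fun_bilinear.

Definition tensor_map : {linear tensor M N -> tensor M' N'} :=
  tensor_lift tensor_map_fun.

Lemma tensor_mapE m n : tensor_map (m ⊗ n) = f m ⊗ g n.
Proof. exact: tensor_liftE. Qed.

End TensorMap.

(* Antisymmetry only: when 2 = 0 in K this is weaker than [br x x = 0]. *)
Definition is_homLie (K : fieldType) (L : lmodType K)
    (br : {bilinear L -> L -> L}) (alpha : {linear L -> L}) : Prop :=
  [/\ forall x y, br x y = - br y x,
      forall x y z,
        br (alpha x) (br y z) + br (alpha z) (br x y)
          + br (alpha y) (br z x) = 0
    & forall x y, alpha (br x y) = br (alpha x) (alpha y)].

(* [act x m] is the action of x on m; bilinear maps stand for linear maps out
   of the tensor product, see [tensor_lift], [tensor_liftE], [tensor_ext]. *)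
Definition is_homAction (K : fieldType) (L M : lmodType K)
    (brL : {bilinear L -> L -> L}) (alphaL : {linear L -> L})
    (brM : {bilinear M -> M -> M}) (alphaM : {linear M -> M})
    (act : {bilinear L -> M -> M}) : Prop :=
  [/\ forall x y m,
        act (brL x y) (alphaM m)
          = act (alphaL x) (act y m) - act (alphaL y) (act x m),
      forall x m m',
        act (alphaL x) (brM m m')
          = brM (act x m) (alphaM m') + brM (alphaM m) (act x m')
    & forall x m, alphaM (act x m) = act (alphaL x) (alphaM m)].

Definition compatible_actions (K : fieldType) (M N : lmodType K)
    (brM : {bilinear M -> M -> M}) (brN : {bilinear N -> N -> N})
    (actM : {bilinear M -> N -> N}) (actN : {bilinear N -> M -> M}) : Prop :=
  (forall m m' n, actN (actM m n) m' = brM m' (actN n m)) /\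
  (forall m n n', actM (actN n m) n' = brN n' (actM m n)).

(* Below, [actM m n] is the action of m : M on n : N, and [actN n m] that of n
   on m. *)
Section NonabelianTensor.
Variables (K : fieldType) (M N : lmodType K).
Variables (brM : {bilinear M -> M -> M}) (alphaM : {linear M -> M}).
Variables (brN : {bilinear N -> N -> N}) (alphaN : {linear N -> N}).
Variables (actM : {bilinear M -> N -> N}) (actN : {bilinear N -> M -> M}).

Inductive D_gen : tensor M N -> Prop :=
| D_gen_a m m' n :
    D_gen (brM m m' ⊗ alphaN n - alphaM m ⊗ actM m' n + alphaM m' ⊗ actM m n)
| D_gen_b m n n' :
    D_gen (alphaM m ⊗ brN n n' - actN n' m ⊗ alphaN n + actN n m ⊗ alphaN n')
| D_gen_c m n :
    D_gen (actN n m ⊗ actM m n)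
| D_gen_d m m' n n' :
    D_gen (actN n m ⊗ actM m' n' + actN n' m' ⊗ actM m n)
| D_gen_e m m' m'' n n' n'' :
    D_gen (brM (actN n m) (actN n' m') ⊗ alphaN (actM m'' n'')
         + brM (actN n' m') (actN n'' m'') ⊗ alphaN (actM m n)
         + brM (actN n'' m'') (actN n m) ⊗ alphaN (actM m' n')).

End NonabelianTensor.

(* A product on a quotient of [M ⊗ N] is determined by its values on the classes
   of the elements [m ⊗ n]. *)
Lemma quotv_bilinear_ext (K : fieldType) (M N V : lmodType K)
    (G : tensor M N -> Prop)
    (b1 b2 : {bilinear quotv G -> quotv G -> V}) :
    (forall m n m' n', b1 (cls G (m ⊗ n)) (cls G (m' ⊗ n'))
                         = b2 (cls G (m ⊗ n)) (cls G (m' ⊗ n'))) ->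
  forall p q, b1 p q = b2 p q.
Proof.
move=> b12 p q; have [t ->] := cls_surj p; have [u ->] := cls_surj q.
elim/tensor_ind: t => [m n||a t1 t2 IH1 IH2].
- elim/tensor_ind: u => [m' n'||a u1 u2 IH1 IH2] //.
    by rewrite linear0 !linear0r.
  by rewrite linearP !linearPr IH1 IH2.
- by rewrite linear0 !linear0l.
by rewrite linearP !linearPl IH1 IH2.
Qed.

(* Main.v *)
From HB Require Import structures.
Require Import Defs.
From mathcomp Require Import all_boot all_algebra.

Set Implicit Arguments.
Unset Strict Implicit.
Unset Printing Implicit Defensive.

Import GRing.Theory.

Local Open Scope ring_scope.

(** The actions give linear maps p : M ⊗ N -> M, m ⊗ n |-> ^n m, and
    q : M ⊗ N -> N, m ⊗ n |-> ^m n, and the product of the statement reads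
    [t, u] = - p(t) ⊗ q(u).  It therefore descends to the quotient by D as soon
    as p and q vanish on D ([toM_D_gen], [toN_D_gen]), and each of the five
    families of generators is killed for its own reason: once compatibility has
    rewritten iterated actions as brackets, (a) and (b) vanish by the action
    axioms, (c) by [x, x] = 0, (d) by antisymmetry and (e) by the Hom-Jacobi
    identity in M or in N.

    Once the product exists, antisymmetry is exactly the relation (d), extended
    bilinearly ([cls_tens_toM_toN_anti]).  For Hom-Jacobi, compatibility gives
    p(p(t) ⊗ q(u)) = [p(t), p(u)] ([actN_toN]), so, after one use of
    antisymmetry, [α x, [y, z]] is the class of - [p(y), p(z)] ⊗ α(q(x)); the
    cyclic sum of these is the relation (e), extended trilinearly
    ([cls_jacobi]).  Multiplicativity holds because p and q commute with the
    twisting maps, and the twisting map of M ⊗ N descends because it sends each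
    generator of D to a generator of the same family. *)

(** * Preliminaries *)

(** Outside characteristic 2 antisymmetry already forces [x, x] = 0. *)
Lemma antisym_alt (K : fieldType) (L : lmodType K) (br : L -> L -> L) :
    (2%N \in [pchar K] -> forall x, br x x = 0) ->
    (forall x y, br x y = - br y x) ->
  forall x, br x x = 0.
Proof.
move=> alt anti x; have [/alt // | char2] := boolP (2%N \in [pchar K]).
have two_neq0 : (2%:R : K) != 0 by move: char2; rewrite inE.
have : (2%:R : K) *: br x x = 0 by rewrite scaler_nat mulr2n {1}anti addNr.
by move/eqP; rewrite scaler_eq0 (negPf two_neq0) => /eqP.
Qed.

(** Cyclic invariance turns linearity in the first argument into linearity in
    all three, so such a map is determined by its values on pure tensors. *)
Lemma cyclic_trilinear_eq0 (K : fieldType) (M N V : lmodType K)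
    (F : tensor M N -> tensor M N -> tensor M N -> V) :
    (forall x y z, F x y z = F y z x) ->
    (forall a x x' y z, F (a *: x + x') y z = a *: F x y z + F x' y z) ->
    (forall m n m' n' m'' n'', F (m ⊗ n) (m' ⊗ n') (m'' ⊗ n'') = 0) ->
  forall x y z, F x y z = 0.
Proof.
move=> cycF linF F0.
have F00 y z : F 0 y z = 0.
  by have := linF (-1) 0 0 y z; rewrite scaler0 add0r scaleN1r addNr.
have ext y z : (forall m n, F (m ⊗ n) y z = 0) -> forall x, F x y z = 0.
  move=> Fyz; elim/tensor_ind=> // a t u Ft Fu.
  by rewrite linF Ft Fu scaler0 addr0.
move=> x y z; apply: (ext _ _) => m n; rewrite cycF; apply: (ext _ _) => m' n'.
by rewrite cycF; apply: (ext _ _) => m'' n''; rewrite cycF.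
Qed.

Section NonabelianTensorProduct.
Variables (K : fieldType) (M N : lmodType K).
Variables (brM : {bilinear M -> M -> M}) (alphaM : {linear M -> M}).
Variables (brN : {bilinear N -> N -> N}) (alphaN : {linear N -> N}).
Variables (actM : {bilinear M -> N -> N}) (actN : {bilinear N -> M -> M}).

(** The universal property of M ⊗ N takes the element of M first. *)
Definition flip_actN (m : M) (n : N) : M := actN n m.

Fact flip_actN_bilinear : bilinear_for *:%R *:%R flip_actN.
Proof.
by split=> [n|m] a x y; rewrite /flip_actN ?linearPr ?linearPl.
Qed.

HB.instance Definition _ := bilinear_isBilinear.Build K M N M
  *:%R *:%R flip_actN flip_actN_bilinear.

Definition toM : tensor M N -> M := tensor_lift flip_actN.
Definition toN : tensor M N -> N := tensor_lift actM.

HB.instance Definition _ := GRing.Linear.on toM.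
HB.instance Definition _ := GRing.Linear.on toN.

Lemma toME m n : toM (m ⊗ n) = actN n m.
Proof. exact: tensor_liftE. Qed.

Lemma toNE m n : toN (m ⊗ n) = actM m n.
Proof. exact: tensor_liftE. Qed.

Hypotheses (homLieM : is_homLie brM alphaM) (homLieN : is_homLie brN alphaN).
Hypothesis altM : 2%N \in [pchar K] -> forall x : M, brM x x = 0.
Hypothesis altN : 2%N \in [pchar K] -> forall x : N, brN x x = 0.
Hypothesis homActM : is_homAction brM alphaM brN alphaN actM.
Hypothesis homActN : is_homAction brN alphaN brM alphaM actN.
Hypothesis compat : compatible_actions brM brN actM actN.

Let D := D_gen brM alphaM brN alphaN actM actN.

(** * The two projections vanish on D *)

Lemma brM_actN m n m' n' :
  brM (actN n m) (actN n' m') = actN (actM m' n') (actN n m).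
Proof. by have [-> _] := compat. Qed.

(** Compatibility turns ^(^m n) x into [x, ^n m], after which the families (a)-(e)
    need, in this order: the derivation axiom, the action axiom for [n, n'],
    [x, x] = 0, antisymmetry, and Hom-Jacobi in M. *)
Lemma toM_D_gen t : D t -> toM t = 0.
Proof.
have [antiM jacM _] := homLieM; have [_ _ eqM] := homActM.
have [actN_br actN_der eqN] := homActN; have [compM _] := compat.
case=> [m m' n|m n n'|m n|m m' n n'|m m' m'' n n' n''].
- rewrite linearD linearB /= !toME actN_der !compM.
  by rewrite addrK (antiM (alphaM m')) subrr.
- rewrite linearD linearB /= !toME actN_br.
  by rewrite addrAC subrK subrr.
- by rewrite toME compM; apply: antisym_alt.
- by rewrite linearD /= !toME !compM antiM addNr.
(* Twisted elements α (^m n) are again of the form ^m n, as α is equivariant. *)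
have act_br a b x : actN (alphaN (actM a b)) x = brM x (alphaM (actN b a)).
  by rewrite eqM compM eqN.
rewrite !linearD /= !toME !act_br !(antiM (brM _ _)) -!opprD.
by rewrite addrAC jacM oppr0.
Qed.

(** The mirror image of [toM_D_gen]: exchanging M and N exchanges the families
    (a) and (b).  In (e), which treats M and N differently, the brackets
    [^n m, ^n' m'] of M first have to be rewritten as actions ([brM_actN]) before
    Hom-Jacobi in N applies. *)
Lemma toN_D_gen t : D t -> toN t = 0.
Proof.
have [antiN jacN _] := homLieN; have [actM_br actM_der eqM] := homActM.
have [_ compN] := compat.
case=> [m m' n|m n n'|m n|m m' n n'|m m' m'' n n' n''].
- rewrite linearD linearB /= !toNE actM_br.
  by rewrite addrAC subrK subrr.
- rewrite linearD linearB /= !toNE actM_der !compN.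
  by rewrite addrK (antiN (alphaN n')) subrr.
- by rewrite toNE compN; apply: antisym_alt.
- by rewrite linearD /= !toNE !compN antiN addNr.
(* [^n m, ^n' m'] acts on N as right bracketing by [^m' n', ^m n]. *)
have act_br a b a' b' y :
    actM (brM (actN b a) (actN b' a')) y = brN y (brN (actM a' b') (actM a b)).
  by rewrite brM_actN !compN.
rewrite !linearD /= !toNE !act_br.
exact: jacN.
Qed.

(** * The product *)

(** The maps induced on the quotient exist only under the hypotheses on the
    actions, which instance inference could not supply; each is therefore
    packed with its linearity proof. *)
Definition qtoM : {linear quotv D -> M} :=
  HB.pack_for {linear quotv D -> M} (quotv_lift toM)
    (GRing.isLinear.Build _ _ _ _ _ (quotv_lift_linear toM_D_gen)).

Definition qtoN : {linear quotv D -> N} :=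
  HB.pack_for {linear quotv D -> N} (quotv_lift toN)
    (GRing.isLinear.Build _ _ _ _ _ (quotv_lift_linear toN_D_gen)).

Lemma qtoME t : qtoM (cls D t) = toM t.
Proof. exact: quotv_liftE toM_D_gen t. Qed.

Lemma qtoNE t : qtoN (cls D t) = toN t.
Proof. exact: quotv_liftE toN_D_gen t. Qed.

Definition prod_quot (P Q : quotv D) : quotv D := - cls D (qtoM P ⊗ qtoN Q).

Fact prod_quot_bilinear : bilinear_for *:%R *:%R prod_quot.
Proof.
by split=> [Q|P] a X Y; rewrite /prod_quot linearP ?linearPl ?linearPr
  linearP opprD -scalerN.
Qed.

HB.instance Definition _ := bilinear_isBilinear.Build K (quotv D) (quotv D)
  (quotv D) *:%R *:%R prod_quot prod_quot_bilinear.

Lemma prod_quotE t u : prod_quot (cls D t) (cls D u) = - cls D (toM t ⊗ toN u).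
Proof. by rewrite /prod_quot qtoME qtoNE. Qed.

(** The relation (d), extended bilinearly from pure tensors. *)
Lemma cls_tens_toM_toN_anti t u :
  cls D (toM t ⊗ toN u) = - cls D (toM u ⊗ toN t).
Proof.
elim/tensor_ind: t => [m n||a t1 t2 IH1 IH2].
- elim/tensor_ind: u => [m' n'||a u1 u2 IH1 IH2].
  + rewrite !toME !toNE; apply/eqP; rewrite -subr_eq0 opprK -raddfD.
    by apply/eqP/cls_eq0P/mem_spanned/D_gen_d.
  + by rewrite !linear0 linear0r linear0l !linear0.
  + by rewrite !linearP linearPr linearPl !linearP /= IH1 IH2.
- by rewrite !linear0 linear0r linear0l !linear0.
- by rewrite !linearP linearPr linearPl !linearP /= IH1 IH2.
Qed.

(** This is compatibility, extended linearly from pure tensors; at x = p(t) it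
    says that p sends p(t) ⊗ q(u) to [p(t), p(u)]. *)
Lemma actN_toN u x : actN (toN u) x = brM x (toM u).
Proof.
have [compM _] := compat.
elim/tensor_ind: u => [m n||a u v IHu IHv].
- by rewrite toNE toME compM.
- by rewrite !linear0 linear0l.
- by rewrite !linearP linearPl /= IHu IHv.
Qed.

(** The relation (e), extended trilinearly from pure tensors. *)
Lemma cls_jacobi x y z :
  cls D (brM (toM x) (toM y) ⊗ alphaN (toN z))
  + cls D (brM (toM y) (toM z) ⊗ alphaN (toN x))
  + cls D (brM (toM z) (toM x) ⊗ alphaN (toN y)) = 0.
Proof.
move: x y z; apply: cyclic_trilinear_eq0.
- by move=> x y z; rewrite addrC addrA addrC addrA.
- move=> a x x' y z; rewrite !(linearP, linearPl) /= linearPr linearP /=.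
  by rewrite !scalerDr [RHS]addrACA; congr (_ + _) => //; rewrite addrACA.
- move=> m n m' n' m'' n''; rewrite !toME !toNE -!(raddfD (cls D)).
  by apply/cls_eq0P/mem_spanned/D_gen_e.
Qed.

(** * The twisting map *)

Let alphaT := tensor_map alphaM alphaN.

Lemma toM_alphaT t : toM (alphaT t) = alphaM (toM t).
Proof.
have [_ _ eqN] := homActN.
elim/tensor_ind: t => [m n||a t u IHt IHu].
- by rewrite tensor_mapE !toME eqN.
- by rewrite !linear0.
- by rewrite !linearP /= IHt IHu.
Qed.

Lemma toN_alphaT t : toN (alphaT t) = alphaN (toN t).
Proof.
have [_ _ eqM] := homActM.
elim/tensor_ind: t => [m n||a t u IHt IHu].
- by rewrite tensor_mapE !toNE eqM.
- by rewrite !linear0.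
- by rewrite !linearP /= IHt IHu.
Qed.

Lemma D_gen_alphaT t : D t -> D (alphaT t).
Proof.
have [_ _ mulM] := homLieM; have [_ _ mulN] := homLieN.
have [_ _ eqM] := homActM; have [_ _ eqN] := homActN.
case=> *; rewrite /alphaT ?linearD ?linearN /= !tensor_mapE.
- by rewrite mulM !eqM; apply: D_gen_a.
- by rewrite mulN !eqN; apply: D_gen_b.
- by rewrite eqM eqN; apply: D_gen_c.
- by rewrite !eqM !eqN; apply: D_gen_d.
(* One twist is kept outside the actions of M, as in the generators (e). *)
- by rewrite !mulM !eqM !eqN -!(eqM (alphaM _)); apply: D_gen_e.
Qed.

Definition cls_alphaT : {linear tensor M N -> quotv D} := cls D \o alphaT.

Lemma cls_alphaT_D_gen t : D t -> cls_alphaT t = 0.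
Proof. by move=> Dt; apply/cls_eq0P/mem_spanned/D_gen_alphaT. Qed.

Definition alpha_quot : {linear quotv D -> quotv D} :=
  HB.pack_for {linear quotv D -> quotv D} (quotv_lift cls_alphaT)
    (GRing.isLinear.Build _ _ _ _ _ (quotv_lift_linear cls_alphaT_D_gen)).

Lemma alpha_quotE t : alpha_quot (cls D t) = cls D (alphaT t).
Proof. exact: quotv_liftE cls_alphaT_D_gen t. Qed.

Lemma prod_quot_anti P Q : prod_quot P Q = - prod_quot Q P.
Proof.
have [t ->] := cls_surj P; have [u ->] := cls_surj Q.
by rewrite !prod_quotE cls_tens_toM_toN_anti.
Qed.

(** Antisymmetry moves the inner product into the left slot, where [actN_toN]
    turns it into a bracket of M. *)
Lemma prod_quot_alpha_prod x y z :
  prod_quot (alpha_quot (cls D x)) (prod_quot (cls D y) (cls D z))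
  = - cls D (brM (toM y) (toM z) ⊗ alphaN (toN x)).
Proof.
rewrite alpha_quotE prod_quotE -raddfN prod_quotE cls_tens_toM_toN_anti.
rewrite toN_alphaT opprK [toM (- _)]linearN /= toME actN_toN.
by rewrite linearNl raddfN.
Qed.

Lemma prod_quot_jacobi P Q S :
  prod_quot (alpha_quot P) (prod_quot Q S)
    + prod_quot (alpha_quot S) (prod_quot P Q)
    + prod_quot (alpha_quot Q) (prod_quot S P) = 0.
Proof.
have [x ->] := cls_surj P; have [y ->] := cls_surj Q.
have [z ->] := cls_surj S; rewrite !prod_quot_alpha_prod -!opprD.
apply/eqP; rewrite oppr_eq0; apply/eqP.
by rewrite [X in X + _]addrC cls_jacobi.
Qed.

Lemma alpha_quot_prod P Q :
  alpha_quot (prod_quot P Q) = prod_quot (alpha_quot P) (alpha_quot Q).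
Proof.
have [t ->] := cls_surj P; have [u ->] := cls_surj Q.
rewrite !alpha_quotE !prod_quotE -!(raddfN (cls D)) alpha_quotE.
by rewrite linearN /alphaT tensor_mapE toM_alphaT toN_alphaT.
Qed.

Lemma prod_quot_homLie : is_homLie prod_quot alpha_quot.
Proof.
split; [exact: prod_quot_anti|exact: prod_quot_jacobi|exact: alpha_quot_prod].
Qed.

End NonabelianTensorProduct.

Theorem proposition2p3 (K : fieldType) (M N : lmodType K)
    (brM : {bilinear M -> M -> M}) (alphaM : {linear M -> M})
    (brN : {bilinear N -> N -> N}) (alphaN : {linear N -> N})
    (actM : {bilinear M -> N -> N}) (actN : {bilinear N -> M -> M})
    (homLieM : is_homLie brM alphaM) (homLieN : is_homLie brN alphaN)
    (altM : 2%N \in [pchar K] -> forall x : M, brM x x = 0)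
    (altN : 2%N \in [pchar K] -> forall x : N, brN x x = 0)
    (homActM : is_homAction brM alphaM brN alphaN actM)
    (homActN : is_homAction brN alphaN brM alphaM actN)
    (compat : compatible_actions brM brN actM actN) :
  let D := D_gen brM alphaM brN alphaN actM actN in
  exists (br : {bilinear quotv D -> quotv D -> quotv D})
         (alpha : {linear quotv D -> quotv D}),
    [/\ forall m n m' n',
          br (cls D (m ⊗ n)) (cls D (m' ⊗ n'))
            = cls D (- (actN n m ⊗ actM m' n')),
        forall t, alpha (cls D t) = cls D (tensor_map alphaM alphaN t)
      & is_homLie br alpha].
Proof.
exists (prod_quot homLieM homLieN altM altN homActM homActN compat).
exists (alpha_quot homLieM homLieN homActM homActN).
split=> [m n m' n'|t|].
- by rewrite /= prod_quotE toME toNE raddfN.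
- exact: alpha_quotE.
- exact: prod_quot_homLie.
Qed.
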